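(* If $X$ is a geodesic space and $x\in X$ is singular, then $x$ is either degenerate or sequentially singular.
   Context: A geodesic space is a metric space in which any two points are joined by a curve whose length equals the distance between them. Let $X$ be a geodesic space with base point $*$ (the choice is immaterial up to equivalence). For $\varepsilon>0$, an $\varepsilon$-chain is a finite sequence $\{x_0,\dots,x_n\}$ in $X$ with $d(x_{i-1},x_i)<\varepsilon$ for all $i$. A basic move adds or removes one point, keeping the endpoints fixed and keeping the result an $\varepsilon$-chain; two $\varepsilon$-chains are $\varepsilon$-homotopic if connected by finitely many basic moves; $[\alpha]_\varepsilon$ is the resulting class. $X_\varepsilon$ is the set of classes of $\varepsilon$-chains starting at $*$, with metric $d_\varepsilon([\alpha]_\varepsilon,[\beta]_\varepsilon)$ equal to the infimum of lengths (sums of consecutive distances) of $\varepsilon$-chains in $[\alpha^{-1}\beta]_\varepsilon$; the endpoint map $\varphi_\varepsilon:X_\varepsilon\to X$ is a regular covering map. A path loop (closed continuous curve) lifts closed to $X_\varepsilon$ if its lifts to $X_\varepsilon$ are loops and lifts open otherwise (by regularity, all lifts are closed or all are open). A point $x$ is regular if $X$ is semilocally simply connected at $x$ (some neighborhood $U$ of $x$ has $\pi_1(U,x)\to\pi_1(X,x)$ trivial), and singular otherwise. A singular point $x$ is degenerate if every neighborhood of $x$ contains a path loop based at $x$ that is nontrivial (not null-homotopic in $X$) and lifts closed to $X_\varepsilon$ for all $\varepsilon>0$. A singular point $x$ is sequentially singular if there are path loops $\gamma_n$ based at $x$ and a strictly decreasing sequence of positive numbers $r_n\searrow 0$ such that,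 for each $n$, $\gamma_n$ lies in $B_{r_n}(x)$ but lifts open to $X_{r_{n+1}}$. The alternatives are not mutually exclusive. *)

(* Defs.v *)
From HB Require Import structures.
From Stdlib Require Import Relation_Operators.
From mathcomp Require Import all_boot all_order all_algebra generic_quotient.
From mathcomp Require Import all_classical all_reals all_analysis.

Set Implicit Arguments.
Unset Strict Implicit.
Unset Printing Implicit Defensive.

Import Order.TTheory GRing.Theory Num.Theory.
Import numFieldNormedType.Exports.

Local Open Scope classical_set_scope.
Local Open Scope ring_scope.
Local Open Scope quotient_scope.

Section Curves.
Context {R : realType} {X : metricType R}.
Implicit Types (x y : X) (f g : R -> X) (p : seq X).

(* Curves are functions on all of R, of which only the restriction to [0, 1]
   is meaningful. *)
Definition is_path f := {within `[0, 1], continuous f}.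

Definition is_loop_at x f := [/\ is_path f, f 0 = x & f 1 = x].

(* The finite sequence x, p_1, ..., p_n is represented by x and p. *)
Definition chain_length x p : R := \sum_(d <- pairmap mdist x p) d.

Definition curve_length f : \bar R :=
  ereal_sup [set (chain_length (f 0) (map f s))%:E | s in itv_partition 0 1].

Definition path_homotopic f g : Prop :=
  exists H : R * R -> X,
    [/\ {within `[0, 1] `*` `[0, 1], continuous H},
        {in `[0, 1], forall t, H (0, t) = f t},
        {in `[0, 1], forall t, H (1, t) = g t},
        {in `[0, 1], forall u, H (u, 0) = f 0} &
        {in `[0, 1], forall u, H (u, 1) = f 1}].

Definition null_homotopic f : Prop := path_homotopic f (cst (f 0)).

Definition semilocally_simply_connected_at x : Prop :=
  exists2 U : set X, nbhs x U &
    forall f, is_loop_at x f -> f @` `[0, 1] `<=` U -> null_homotopic f.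

Definition singular x : Prop := ~ semilocally_simply_connected_at x.

End Curves.

Definition geodesic {R : realType} (X : metricType R) : Prop :=
  forall x y : X, exists f : R -> X,
    [/\ is_path f, f 0 = x, f 1 = y & curve_length f = (mdist x y)%:E].

Section Chains.
Context {R : realType} {X : metricType R} (eps : R).
Implicit Types (x y z : X) (p q r s t : seq X).

Definition is_chain x p : bool := path (fun a b : X => mdist a b < eps) x p.

Definition inserts_one p q : Prop :=
  exists s1 y s2, p = s1 ++ s2 /\ q = s1 ++ y :: s2.

(* The initial point x is shared by both chains; inserting a copy of x in front
   of x :: p gives the same sequence as inserting it right after x. *)
Definition basic_move x p q : Prop :=
  [/\ is_chain x p, is_chain x q, last x p = last x q &
      inserts_one p q \/ inserts_one q p].

Definition chain_homotopic x : seq X -> seq X -> Prop :=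
  clos_refl_sym_trans _ (basic_move x).

(* The reversal of (x, p) followed by (x, q), as a chain from last x p. *)
Definition chain_inv_cat x p q : seq X := rev (belast x p) ++ q.

(* The infimum is over the homotopy class of the reversal of (x, p) followed
   by (x, q). *)
Definition chain_dist x p q : R :=
  inf [set chain_length (last x p) s |
       s in chain_homotopic (last x p) (chain_inv_cat x p q)].

Lemma chain_homotopic_refl x p : chain_homotopic x p p.
Proof. exact: rst_refl. Qed.

Lemma chain_homotopic_sym x p q :
  chain_homotopic x p q -> chain_homotopic x q p.
Proof. exact: rst_sym. Qed.

Lemma chain_homotopic_trans x q p r :
  chain_homotopic x p q -> chain_homotopic x q r -> chain_homotopic x p r.
Proof. exact: rst_trans. Qed.

Lemma chain_homotopic_last x p q : chain_homotopic x p q -> last x p = last x q.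
Proof.
by elim=> [? ? []|//|? ? _ ->|? ? ? _ -> _ ->].
Qed.

Lemma chain_homotopic_chain x p q :
  chain_homotopic x p q -> is_chain x p = is_chain x q.
Proof. by elim=> [? ? [-> ->]|//|? ? _ ->|? ? ? _ -> _ ->]. Qed.

Lemma is_chain_cat x p q :
  is_chain x (p ++ q) = is_chain x p && is_chain (last x p) q.
Proof. exact: cat_path. Qed.

Lemma is_chain_rev x p : is_chain (last x p) (rev (belast x p)) = is_chain x p.
Proof.
rewrite /is_chain rev_path; apply: eq_path => a b.
by rewrite metric_sym.
Qed.

Lemma last_rev_belast x p : last (last x p) (rev (belast x p)) = x.
Proof. by case: p => //= a p; rewrite rev_cons last_rcons. Qed.

Lemma rev_belastK x p :
  rev (belast (last x p) (rev (belast x p))) = p.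
Proof.
elim/last_ind: p => // p a _.
by rewrite belast_rcons last_rcons rev_cons belast_rcons rev_cons revK.
Qed.

Lemma is_chain_inv_cat x p q : is_chain x p -> is_chain x q ->
  is_chain (last x p) (chain_inv_cat x p q).
Proof.
by move=> xp xq; rewrite is_chain_cat is_chain_rev xp last_rev_belast.
Qed.

Lemma last_inv_cat x p q : last (last x p) (chain_inv_cat x p q) = last x q.
Proof. by rewrite last_cat last_rev_belast. Qed.

Lemma inserts_one_cat p q r s :
  inserts_one p q -> inserts_one (r ++ p ++ s) (r ++ q ++ s).
Proof.
move=> [s1 [y [s2 [-> ->]]]]; exists (r ++ s1), y, (s2 ++ s).
by rewrite -!catA.
Qed.

Lemma inserts_one_rev x p q : inserts_one p q ->
  inserts_one (rev (belast x p)) (rev (belast x q)).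
Proof.
move=> [s1 [y [s2 [-> ->]]]]; case: s2 => [|z s2].
  rewrite cats0 cats1.
  exists [::], (last x s1), (rev (belast x s1)).
  by rewrite belast_rcons lastI rev_rcons.
exists (rev (belast z s2)), y, (last x s1 :: rev (belast x s1)).
by rewrite !belast_cat /= !rev_cat !rev_cons -!cats1 -!catA.
Qed.

Lemma chain_homotopic_cat x r p q s : is_chain x r ->
  is_chain (last (last x r) p) s ->
  chain_homotopic (last x r) p q ->
  chain_homotopic x (r ++ p ++ s) (r ++ q ++ s).
Proof.
move=> xr + pq; elim: pq => {p q}.
- move=> p q [cp cq lpq pq] ls; apply: rst_step; split.
  + by rewrite !is_chain_cat xr cp.
  + by rewrite !is_chain_cat xr cq -lpq.
  + by rewrite !last_cat lpq.
  + by case: pq => /inserts_one_cat; [left|right].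
- by move=> p _; exact: rst_refl.
- move=> p q pq IH ls; apply: rst_sym; apply: IH.
  by rewrite (chain_homotopic_last pq).
- move=> p q t pq IH1 qt IH2 ls; apply: (rst_trans _ _ _ _ _ (IH1 ls)).
  by apply: IH2; rewrite -(chain_homotopic_last pq).
Qed.

Lemma chain_homotopic_rev x p q : chain_homotopic x p q ->
  chain_homotopic (last x p) (rev (belast x p)) (rev (belast x q)).
Proof.
elim=> {p q}.
- move=> p q [cp cq lpq pq]; apply: rst_step; split.
  + by rewrite is_chain_rev.
  + by rewrite lpq is_chain_rev.
  + by rewrite last_rev_belast lpq last_rev_belast.
  + by case: pq => /inserts_one_rev; [left|right].
- by move=> p; exact: rst_refl.
- move=> p q pq IH; apply: rst_sym.
  by rewrite -(chain_homotopic_last pq).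
- move=> p q t pq IH1 _ IH2; apply: (rst_trans _ _ _ _ _ IH1).
  by rewrite (chain_homotopic_last pq).
Qed.

Lemma chain_homotopic_cancel x p q : is_chain x p -> is_chain x q ->
  chain_homotopic x (p ++ chain_inv_cat x p q) q.
Proof.
rewrite /chain_inv_cat; elim/last_ind: p => [|p y IH] cpy cq.
  exact: rst_refl.
have /andP[cp py] : is_chain x p && (mdist (last x p) y < eps).
  by move: cpy; rewrite -cats1 is_chain_cat /= andbT.
have py' : mdist y (last x p) < eps by rewrite metric_sym.
have pp : mdist (last x p) (last x p) < eps.
  by rewrite mdistxx (le_lt_trans _ py)// mdist_ge0.
have ct : is_chain (last x p) (rev (belast x p) ++ q).
  by rewrite is_chain_cat is_chain_rev cp last_rev_belast.
apply: chain_homotopic_trans (IH cp cq).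
rewrite belast_rcons cat_rcons (lastI x p) rev_rcons.
apply: (@chain_homotopic_trans _ (p ++ last x p :: rev (belast x p) ++ q)).
- apply: rst_step; split.
  + by rewrite is_chain_cat cp /is_chain /= py py'; exact: ct.
  + by rewrite is_chain_cat cp /is_chain /= pp; exact: ct.
  + by rewrite !last_cat.
  + right; exists p, y, (last x p :: rev (belast x p) ++ q).
    by split.
- apply: rst_step; split.
  + by rewrite is_chain_cat cp /is_chain /= pp; exact: ct.
  + by rewrite is_chain_cat cp; exact: ct.
  + by rewrite last_cat /= -last_cat.
  + by right; exists p, (last x p), (rev (belast x p) ++ q).
Qed.

Lemma chain_length_cons x y p :
  chain_length x (y :: p) = mdist x y + chain_length y p.
Proof. by rewrite /chain_length /= big_cons. Qed.

Lemma chain_length_cat x p q :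
  chain_length x (p ++ q) = chain_length x p + chain_length (last x p) q.
Proof. by rewrite /chain_length pairmap_cat big_cat. Qed.

Lemma chain_length_rev x p :
  chain_length (last x p) (rev (belast x p)) = chain_length x p.
Proof.
elim: p x => [//|y p IH] x /=.
rewrite rev_cons -cats1 chain_length_cat IH last_rev_belast.
by rewrite !chain_length_cons /chain_length /= big_nil addr0 metric_sym addrC.
Qed.

Lemma mdist_le_chain_length x p : mdist x (last x p) <= chain_length x p.
Proof.
elim: p x => [|y p IH] x /=; first by rewrite mdistxx /chain_length big_nil.
rewrite chain_length_cons (le_trans (metric_triangle x y _))//.
by rewrite lerD2l.
Qed.

Lemma chain_length_ge0 x p : 0 <= chain_length x p.
Proof. exact: le_trans (mdist_ge0 _ _) (mdist_le_chain_length x p). Qed.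

Lemma short_chain_null x p : chain_length x p < eps -> last x p = x ->
  chain_homotopic x p [::].
Proof.
case: p => [|y p]; first by move=> *; exact: rst_refl.
elim: p y => [|z p IH] y; rewrite !chain_length_cons.
  rewrite /chain_length big_nil addr0 => xy /= yx; apply: rst_step; split => //.
    by rewrite /is_chain /= xy.
  by right; exists [::], y, [::].
move=> lt_eps lst.
have xz_le : mdist x z <= mdist x y + mdist y z by exact: metric_triangle.
have short : chain_length x (z :: p) < eps.
  by rewrite (le_lt_trans _ lt_eps)// chain_length_cons addrA lerD2r.
have chainW a t : chain_length a t < eps -> is_chain a t.
  elim: t a => // b t IHt a; rewrite chain_length_cons /is_chain /= => abt.
  rewrite (le_lt_trans _ abt) ?lerDl ?chain_length_ge0//=.
  by apply: IHt; rewrite (le_lt_trans _ abt)// lerDr mdist_ge0.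
apply: chain_homotopic_trans (IH z short lst).
apply: rst_step; split => //; [|exact: chainW|].
- by apply: chainW; rewrite !chain_length_cons.
- by right; exists [::], y, (z :: p).
Qed.

Lemma chain_homotopic_inv_cat x p p' q q' :
  is_chain x p -> is_chain x q ->
  chain_homotopic x p p' -> chain_homotopic x q q' ->
  chain_homotopic (last x p) (chain_inv_cat x p q) (chain_inv_cat x p' q').
Proof.
move=> xp xq pp' qq'.
have xp' : is_chain x p' by rewrite -(chain_homotopic_chain pp').
apply: (@chain_homotopic_trans _ (chain_inv_cat x p' q)).
  apply: (@chain_homotopic_cat _ [::] _ _ q) => //.
    by rewrite /= last_rev_belast.
  by move=> /=; exact: chain_homotopic_rev.
have := @chain_homotopic_cat (last x p) (rev (belast x p')) q q' [::].
rewrite !cats0 (chain_homotopic_last pp') last_rev_belast; apply => //.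
by rewrite is_chain_rev.
Qed.

Lemma chain_dist_homotopic x p p' q q' : is_chain x p -> is_chain x q ->
  chain_homotopic x p p' -> chain_homotopic x q q' ->
  chain_dist x p q = chain_dist x p' q'.
Proof.
move=> xp xq pp' qq'; have pq := chain_homotopic_inv_cat xp xq pp' qq'.
rewrite /chain_dist -(chain_homotopic_last pp'); congr inf.
apply/seteqP; split => _ [s ? <-]; exists s => //.
  exact: chain_homotopic_trans (chain_homotopic_sym pq) _.
exact: chain_homotopic_trans pq _.
Qed.

Let lengths x p q := [set chain_length (last x p) s |
  s in chain_homotopic (last x p) (chain_inv_cat x p q)].

Let lengths_inf x p q : has_inf (lengths x p q).
Proof.
split; first by eexists; exists (chain_inv_cat x p q) => //; exact: rst_refl.
by exists 0 => _ [s _ <-]; exact: chain_length_ge0.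
Qed.

Lemma chain_dist_le x p q s :
  chain_homotopic (last x p) (chain_inv_cat x p q) s ->
  chain_dist x p q <= chain_length (last x p) s.
Proof.
by move=> pqs; apply: ge_inf; [case: (lengths_inf x p q)|exists s].
Qed.

Lemma chain_dist_ge x p q (a : R) :
  (forall s, chain_homotopic (last x p) (chain_inv_cat x p q) s ->
    a <= chain_length (last x p) s) -> a <= chain_dist x p q.
Proof.
move=> H; apply: lb_le_inf; first by case: (lengths_inf x p q).
by move=> _ [s /H ? <-].
Qed.

Lemma chain_dist_lt x p q (a : R) : chain_dist x p q < a ->
  exists2 s, chain_homotopic (last x p) (chain_inv_cat x p q) s &
    chain_length (last x p) s < a.
Proof.
move=> /inf_lt; move=> /(_ (lengths_inf x p q).1)[_ [s pqs <-] sa].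
by exists s.
Qed.

Lemma mdist_le_chain_dist x p q :
  mdist (last x p) (last x q) <= chain_dist x p q.
Proof.
apply: chain_dist_ge => s /chain_homotopic_last.
by rewrite last_inv_cat => ->; exact: mdist_le_chain_length.
Qed.

Lemma chain_dist_ge0 x p q : 0 <= chain_dist x p q.
Proof. exact: le_trans (mdist_ge0 _ _) (mdist_le_chain_dist x p q). Qed.

Lemma chain_distxx x p : is_chain x p -> chain_dist x p p = 0.
Proof.
move=> xp; apply/eqP; rewrite eq_le chain_dist_ge0 andbT.
have -> : 0 = chain_length (last x p) [::] by rewrite /chain_length big_nil.
apply: chain_dist_le.
have := @chain_homotopic_cancel (last x p) (rev (belast x p)) [::].
rewrite /chain_inv_cat rev_belastK cats0; apply => //.
by rewrite is_chain_rev.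
Qed.

Lemma chain_dist_sym x p q : is_chain x p -> is_chain x q ->
  chain_dist x p q = chain_dist x q p.
Proof.
move: p q; suff H p q : is_chain x p -> is_chain x q ->
    chain_dist x q p <= chain_dist x p q.
  by move=> p q xp xq; apply/eqP; rewrite eq_le !H.
move=> xp xq; apply: chain_dist_ge => s pqs.
have ls : last (last x p) s = last x q.
  by rewrite -(chain_homotopic_last pqs) last_inv_cat.
rewrite -chain_length_rev ls; apply: chain_dist_le.
have := chain_homotopic_rev pqs; rewrite last_inv_cat.
rewrite /chain_inv_cat belast_cat rev_cat last_rev_belast.
by rewrite rev_belastK.
Qed.

Lemma chain_dist_triangle x q p r :
  is_chain x p -> is_chain x q -> is_chain x r ->
  chain_dist x p r <= chain_dist x p q + chain_dist x q r.
Proof.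
move=> xp xq xr; apply/ler_addgt0Pl => e e0.
have e20 : 0 < e / 2 by rewrite divr_gt0.
have [s pqs sd] : exists2 s,
    chain_homotopic (last x p) (chain_inv_cat x p q) s &
    chain_length (last x p) s < chain_dist x p q + e / 2.
  by apply: chain_dist_lt; rewrite ltrDl.
have [t qrt td] : exists2 t,
    chain_homotopic (last x q) (chain_inv_cat x q r) t &
    chain_length (last x q) t < chain_dist x q r + e / 2.
  by apply: chain_dist_lt; rewrite ltrDl.
have ls : last (last x p) s = last x q.
  by rewrite -(chain_homotopic_last pqs) last_inv_cat.
apply: (@le_trans _ _ (chain_length (last x p) (s ++ t))); last first.
  rewrite chain_length_cat ls (le_trans (lerD (ltW sd) (ltW td)))//.
  by rewrite addrACA -splitr addrC.
apply: chain_dist_le.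
have cp : is_chain (last x p) (rev (belast x p)) by rewrite is_chain_rev.
have cpq := is_chain_inv_cat xp xq.
have cqr := is_chain_inv_cat xq xr.
apply: (@chain_homotopic_trans _
  (rev (belast x p) ++ (q ++ chain_inv_cat x q r) ++ [::])).
  apply: chain_homotopic_sym; rewrite /(chain_inv_cat x p r) -[r in X in _ _ X]cats0.
  apply: chain_homotopic_cat => //; rewrite last_rev_belast.
  exact: chain_homotopic_cancel.
rewrite cats0 catA -/(chain_inv_cat x p q).
apply: (@chain_homotopic_trans _ (s ++ chain_inv_cat x q r)).
  by apply: (@chain_homotopic_cat _ [::] _ _ (chain_inv_cat x q r));
    rewrite /= ?last_inv_cat.
have := @chain_homotopic_cat (last x p) s (chain_inv_cat x q r) t [::].
by rewrite !cats0 ls; apply => //; rewrite -(chain_homotopic_chain pqs).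
Qed.

Lemma chain_dist_eq0 x p q : is_chain x p -> is_chain x q ->
  chain_dist x p q = 0 -> chain_homotopic x p q.
Proof.
move=> xp xq pq0; case: (ltP 0 eps) => [eps0|eps_le0]; last first.
  have nil_chain t : is_chain x t -> t = [::].
    case: t => // a t /andP[/lt_le_trans/(_ eps_le0)].
    by rewrite ltNge mdist_ge0.
  by rewrite (nil_chain p xp) (nil_chain q xq); exact: rst_refl.
have lpq : last x p = last x q.
  apply: (@mdist_positivity R); apply/eqP; rewrite eq_le mdist_ge0 andbT -pq0.
  exact: mdist_le_chain_dist.
have [s pqs s_eps] : exists2 s,
    chain_homotopic (last x p) (chain_inv_cat x p q) s &
    chain_length (last x p) s < eps.
  by apply: chain_dist_lt; rewrite pq0.
have ls : last (last x p) s = last x p.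
  by rewrite -(chain_homotopic_last pqs) last_inv_cat lpq.
have s0 := chain_homotopic_trans pqs (short_chain_null s_eps ls).
apply: chain_homotopic_trans (chain_homotopic_cancel xp xq).
apply: chain_homotopic_sym.
have := @chain_homotopic_cat x p (chain_inv_cat x p q) [::] [::].
by rewrite !cats0; apply.
Qed.

End Chains.

Section Cover.
Context {R : realType} {X : metricType R} (base : X) (eps : R).

Definition chain_from : Type := {p : seq X | is_chain eps base p}.
HB.instance Definition _ := Choice.on chain_from.

Definition chain_equiv (p q : chain_from) : bool :=
  `[< chain_homotopic eps base (sval p) (sval q) >].

Let chain_equiv_refl : reflexive chain_equiv.
Proof. by move=> p; apply/asboolP; exact: rst_refl. Qed.

Let chain_equiv_sym : symmetric chain_equiv.
Proof.
by move=> p q; apply/idP/idP => /asboolP h; apply/asboolP; exact: rst_sym.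
Qed.

Let chain_equiv_trans : transitive chain_equiv.
Proof.
move=> q p r /asboolP pq /asboolP qr; apply/asboolP.
exact: chain_homotopic_trans pq qr.
Qed.

Canonical chain_equiv_canonical :=
  EquivRel chain_equiv chain_equiv_refl chain_equiv_sym chain_equiv_trans.

Definition chain_cover : Type := {eq_quot chain_equiv}.
HB.instance Definition _ := Choice.on chain_cover.
HB.instance Definition _ := EqQuotient.on chain_cover.

Definition cover_dist (u v : chain_cover) : R :=
  chain_dist eps base (sval (repr u)) (sval (repr v)).

Definition cover_end (u : chain_cover) : X := last base (sval (repr u)).

Let repr_chain (u : chain_cover) : is_chain eps base (sval (repr u)).
Proof. exact: svalP (repr u). Qed.

Lemma repr_chain_homotopic (p : chain_from) :
  chain_homotopic eps base (sval (repr (\pi_chain_cover p))) (sval p).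
Proof.
apply/asboolP; rewrite -/(chain_equiv (repr (\pi_chain_cover p)) p).
by have /eqmodP := reprK (\pi_chain_cover p).
Qed.

Lemma cover_dist_pi (p q : chain_from) :
  cover_dist (\pi_chain_cover p) (\pi_chain_cover q) =
  chain_dist eps base (sval p) (sval q).
Proof.
apply: chain_dist_homotopic.
- exact: repr_chain.
- exact: repr_chain.
- exact: repr_chain_homotopic.
- exact: repr_chain_homotopic.
Qed.

Lemma cover_end_pi (p : chain_from) :
  cover_end (\pi_chain_cover p) = last base (sval p).
Proof. exact/chain_homotopic_last/repr_chain_homotopic. Qed.

Let cover_distxx u : cover_dist u u = 0.
Proof. by exact: chain_distxx. Qed.

Let cover_dist_positivity u v : cover_dist u v = 0 -> u = v.
Proof.
move=> uv0; rewrite -(reprK u) -(reprK v); apply/eqmodP/asboolP.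
by apply: chain_dist_eq0 uv0; exact: repr_chain.
Qed.

Let cover_dist_sym u v : cover_dist u v = cover_dist v u.
Proof. by apply: chain_dist_sym; exact: repr_chain. Qed.

Let cover_dist_triangle v u w :
  cover_dist u w <= cover_dist u v + cover_dist v w.
Proof. by apply: chain_dist_triangle; exact: repr_chain. Qed.

HB.instance Definition _ := isMetric.Build R chain_cover
  cover_distxx cover_dist_positivity cover_dist_sym cover_dist_triangle.

Lemma mdist_coverE (u v : chain_cover) : mdist u v = cover_dist u v.
Proof. by []. Qed.

Definition is_lift (f : R -> X) (g : R -> chain_cover) : Prop :=
  is_path g /\ {in `[0, 1], forall t, cover_end (g t) = f t}.

(* On a geodesic space, the endpoint map is a regular covering map: lifts of a
   loop exist, and they are all closed or all open. *)
Definition lifts_closed (f : R -> X) : Prop :=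
  forall g, is_lift f g -> g 0 = g 1.

Definition lifts_open (f : R -> X) : Prop := ~ lifts_closed f.

End Cover.

Section SingularPoints.
Context {R : realType} {X : metricType R} (base x : X).

Definition degenerate : Prop :=
  singular x /\
  forall U : set X, nbhs x U ->
    exists f : R -> X,
      [/\ is_loop_at x f, f @` `[0, 1] `<=` U, ~ null_homotopic f &
          forall eps : R, 0 < eps -> lifts_closed base eps f].

Definition sequentially_singular : Prop :=
  singular x /\
  exists (gamma : nat -> R -> X) (r : nat -> R),
    [/\ forall n, 0 < r n,
        forall n, r n.+1 < r n,
        r @ \oo --> (0 : R) &
        forall n,
          [/\ is_loop_at x (gamma n), gamma n @` `[0, 1] `<=` ball x (r n) &
              lifts_open base (r n.+1) (gamma n)]].

End SingularPoints.

(* Main.v *)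
Require Import Defs.
From Stdlib Require Import Relation_Operators.
From mathcomp Require Import all_boot all_order all_algebra generic_quotient.
From mathcomp Require Import all_classical all_reals all_analysis.
From mathcomp Require Import lra.

(** If [x] is singular but not degenerate, some neighborhood [U] of [x] contains
    no nontrivial loop at [x] that lifts closed at every scale.  Singularity
    puts a nontrivial loop at [x] in every ball around [x]; once the ball of
    radius [r] lies in [U], that loop lifts open at some scale [eps].  The
    definition of sequential singularity uses one number both as that scale and
    as the radius of the next ball, so the number taken is
    [r' := min eps (r / 2)]; iterating [r |-> r'] gives the sequences of a
    sequentially singular point.

    The one substantial ingredient is that lifting open passes to smaller
    scales ([lifts_closedW], in contrapositive form).  It follows from a
    description of lifts by chains.  Sample a path [f] on the part of a uniform
    grid that precedes [t], ending with [f t] itself.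
    - Every lift [g] of [f] satisfies [g t = g 0 ++ (samples of f up to t)] as
      soon as the mesh is small for [g] ([lift_samples]).
    - Conversely, for every chain [a] ending at [f 0], the classes of
      [a ++ (samples of f up to t)] form a lift of [f] ([lift_of_samples]).
    Let [d <= e].  If all lifts of [f] at scale [d] are closed, then so is the
    one built from samples, hence the samples of [f] up to time 0 and up to time
    1 are [d]-homotopic; they are a fortiori [e]-homotopic, so a lift [g] at
    scale [e] has [g 0 = g 1].  Geodesics serve to join the base point to [f 0]
    by a [d]-chain, from which the lift at scale [d] starts. *)

Set Implicit Arguments.
Unset Strict Implicit.
Unset Printing Implicit Defensive.

Import Order.TTheory GRing.Theory Num.Theory.
Import numFieldNormedType.Exports.

Local Open Scope classical_set_scope.
Local Open Scope ring_scope.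
Local Open Scope quotient_scope.

(** * Homotopies of chains *)

Section ChainHomotopy.
Context {R : realType} {X : metricType R} (eps : R).
Implicit Types (x y : X) (p q s : seq X) (u v : nat -> X).

Lemma chain_homotopic_insert x p y q :
  is_chain eps x (p ++ q) -> is_chain eps x (p ++ y :: q) ->
  last (last x p) q = last y q ->
  chain_homotopic eps x (p ++ q) (p ++ y :: q).
Proof.
move=> cpq cpyq lq; apply: rst_step; split => //; first by rewrite !last_cat.
by left; exists p, y, q.
Qed.

Lemma chain_homotopic_catr x p q s : is_chain eps (last x p) s ->
  chain_homotopic eps x p q -> chain_homotopic eps x (p ++ s) (q ++ s).
Proof. by move=> ls pq; exact: (@chain_homotopic_cat _ _ _ _ [::]). Qed.

Lemma chain_homotopic_catl x r p q : is_chain eps x r ->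
  chain_homotopic eps (last x r) p q ->
  chain_homotopic eps x (r ++ p) (r ++ q).
Proof.
move=> xr pq; rewrite -(cats0 p) -(cats0 q).
exact: chain_homotopic_cat.
Qed.

Lemma chain_homotopic_retrace x p q : is_chain eps x p ->
  is_chain eps (last x p) q ->
  chain_homotopic eps (last x p) (chain_inv_cat x p (p ++ q)) q.
Proof.
move=> xp lq; rewrite /chain_inv_cat -[p in p ++ q](rev_belastK x).
by apply: chain_homotopic_cancel; rewrite ?is_chain_rev.
Qed.

(** Left cancellation, as in a groupoid: prepend the reversal of [r] to both
    sides and retract. *)
Lemma chain_homotopic_catlI x r p q : is_chain eps x r ->
  is_chain eps (last x r) p -> is_chain eps (last x r) q ->
  chain_homotopic eps x (r ++ p) (r ++ q) ->
  chain_homotopic eps (last x r) p q.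
Proof.
move=> xr rp rq rprq.
apply: chain_homotopic_trans (chain_homotopic_retrace xr rq).
apply: chain_homotopic_trans
  (chain_homotopic_sym (chain_homotopic_retrace xr rp)) _.
by apply: chain_homotopic_catl; rewrite ?is_chain_rev ?last_rev_belast.
Qed.

Lemma short_is_chain x p : chain_length x p < eps -> is_chain eps x p.
Proof.
elim: p x => // y p IH x; rewrite chain_length_cons /is_chain /= => xyp.
rewrite (le_lt_trans _ xyp) ?lerDl ?chain_length_ge0//=.
by apply: IH; rewrite (le_lt_trans _ xyp)// lerDr mdist_ge0.
Qed.

(** In a chain shorter than [eps] all points are within [eps] of each other, so
    the interior points can be removed one at a time. *)
Lemma short_chain_homotopic x p : chain_length x p < eps ->
  chain_homotopic eps x p [:: last x p].
Proof.
elim: p x => [|y p IH] x lt_eps.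
  apply: (@chain_homotopic_insert x [::] x [::]) => //=.
  by move: lt_eps; rewrite /is_chain /chain_length /= big_nil mdistxx andbT.
have xyp := short_is_chain lt_eps.
have := lt_eps; rewrite chain_length_cons => lt_eps'.
have yp : chain_length y p < eps.
  by rewrite (le_lt_trans _ lt_eps')// lerDr mdist_ge0.
have xlst : is_chain eps x [:: last y p].
  rewrite /is_chain /= andbT (le_lt_trans _ lt_eps)//.
  exact: (mdist_le_chain_length x (y :: p)).
have /andP[xy _] := xyp.
apply: (@chain_homotopic_trans _ _ _ _ [:: y; last y p]).
  apply: (@chain_homotopic_catl x [:: y]) (IH _ yp).
  by rewrite /is_chain /= xy.
apply: chain_homotopic_sym; apply: (@chain_homotopic_insert x [::]) => //.
rewrite /is_chain /= xy andbT (le_lt_trans _ yp)//.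
exact: mdist_le_chain_length.
Qed.

(** Locally the covering space looks like [X]: a class at distance less than
    [eps] from that of [p] is obtained from [p] by one more step. *)
Lemma chain_dist_homotopic_rcons x p q :
  is_chain eps x p -> is_chain eps x q -> chain_dist eps x p q < eps ->
  chain_homotopic eps x q (rcons p (last x q)).
Proof.
move=> xp xq /chain_dist_lt[s pqs seps].
rewrite -cats1; apply: chain_homotopic_trans
  (chain_homotopic_sym (chain_homotopic_cancel xp xq)) _.
apply: chain_homotopic_catl => //; apply: (chain_homotopic_trans pqs).
have -> : last x q = last (last x p) s.
  by rewrite -(chain_homotopic_last pqs) last_inv_cat.
exact: short_chain_homotopic.
Qed.

Lemma chain_dist_rcons x p y : is_chain eps x (rcons p y) ->
  chain_dist eps x p (rcons p y) <= mdist (last x p) y.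
Proof.
rewrite -cats1 is_chain_cat => /andP[xp py].
have -> : mdist (last x p) y = chain_length (last x p) [:: y].
  by rewrite chain_length_cons /chain_length /= big_nil addr0.
by apply: chain_dist_le; exact: chain_homotopic_retrace.
Qed.

(** The points are shifted by one because the initial point [u 0] of a chain is
    kept apart from the list of the points that follow it. *)
Definition walk u n : seq X := mkseq (u \o S) n.

Lemma last_walk u n : last (u 0) (walk u n) = u n.
Proof. by case: n => // n; rewrite /walk mkseqS last_rcons. Qed.

Lemma is_chain_walk u n : (forall i, mdist (u i) (u i.+1) < eps) ->
  is_chain eps (u 0) (walk u n).
Proof.
move=> ueps; elim: n => // n IH.
by rewrite /walk mkseqS -cats1 is_chain_cat IH last_walk /is_chain /= ueps.
Qed.

(** Two walks that stay close to each other are homotopic rung by rung: in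
    [.., u n, u n.+1, v n.+1] drop [u n.+1], and then insert [v n], which makes
    the previous rung [u n, v n] appear. *)
Lemma walk_ladder u v n : u 0 = v 0 ->
  (forall i, mdist (u i) (u i.+1) < eps) ->
  (forall i, mdist (v i) (v i.+1) < eps) ->
  (forall i, mdist (u i) (v i) < eps) ->
  (forall i, mdist (u i) (v i.+1) < eps) ->
  chain_homotopic eps (u 0) (rcons (walk u n) (v n)) (walk v n).
Proof.
move=> uv0 uu vv uv uv1; elim: n => [|n IH].
  apply: chain_homotopic_sym; apply: (@chain_homotopic_insert _ [::]) => //.
  by rewrite /is_chain /= uv.
rewrite /walk !mkseqS -/(walk u n) -/(walk v n) -!cats1 -catA /=.
have cu := is_chain_walk n uu.
have cu1 : is_chain eps (u 0) (walk u n ++ [:: v n.+1]).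
  by rewrite is_chain_cat cu last_walk /is_chain /= uv1.
apply: (@chain_homotopic_trans _ _ _ _ (walk u n ++ [:: v n.+1])).
  apply/chain_homotopic_sym/chain_homotopic_insert => //.
  by rewrite is_chain_cat cu last_walk /is_chain /= uu uv.
apply: (@chain_homotopic_trans _ _ _ _ (walk u n ++ [:: v n; v n.+1])).
  apply: chain_homotopic_insert => //.
  by rewrite is_chain_cat cu last_walk /is_chain /= uv vv.
rewrite -cat_rcons; apply: chain_homotopic_catr IH.
by rewrite last_rcons /is_chain /= vv.
Qed.

End ChainHomotopy.

Lemma chain_homotopicW (R : realType) (X : metricType R) (d e : R) (x : X)
    (p q : seq X) : d <= e ->
  chain_homotopic d x p q -> chain_homotopic e x p q.
Proof.
move=> de; have W s : is_chain d x s -> is_chain e x s.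
  by apply: sub_path => a b /lt_le_trans; exact.
elim=> [a b [/W ca /W cb lab ab]|a|a b _|a b c _ ab _].
- exact: rst_step.
- exact: rst_refl.
- exact: rst_sym.
- exact: rst_trans.
Qed.

(** * Sampling a path on a uniform grid *)

Section Sampling.
Context {R : realType}.
Implicit Types s t : R.

(** Truncating the grid at [t], instead of stopping at the last grid point
    before [t], keeps the number of sample points independent of [t], so that
    the samples up to two nearby times form a ladder. *)
Definition grid N t (i : nat) : R := Num.min t (i%:R / N.+1%:R).

Lemma grid_itv N t i : t \in `[0, 1] -> grid N t i \in `[0, 1].
Proof.
rewrite !in_itv /= => /andP[t0 t1]; rewrite /grid le_min t0 ge_min t1 /= andbT.
by rewrite divr_ge0.
Qed.

Lemma grid0 N t : t \in `[0, 1] -> grid N t 0 = 0.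
Proof. by rewrite in_itv /= => /andP[t0 _]; rewrite /grid mul0r min_r. Qed.

Lemma gridN N t : t \in `[0, 1] -> grid N t N.+1 = t.
Proof.
rewrite in_itv /= => /andP[_ t1]; rewrite /grid divff ?pnatr_eq0//.
by rewrite min_l.
Qed.

Lemma dist_min (a b s t e : R) : `|a - b| <= e -> `|s - t| <= e ->
  `|Num.min s a - Num.min t b| <= e.
Proof.
rewrite !ler_norml => /andP[? ?] /andP[? ?].
by rewrite !minEle; case: ifPn; rewrite -?ltNge; case: ifPn;
  rewrite -?ltNge => ? ?; apply/andP; split; lra.
Qed.

Lemma dist_grid N s t i : `|s - t| <= N.+1%:R^-1 ->
  `|grid N s i - grid N t i| <= N.+1%:R^-1.
Proof. by apply: dist_min; rewrite subrr normr0 invr_ge0. Qed.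

Lemma dist_gridS N s t i : `|s - t| <= N.+1%:R^-1 ->
  `|grid N s i - grid N t i.+1| <= N.+1%:R^-1.
Proof.
apply: dist_min; rewrite -mulrBl -natr1 opprD addNKr.
by rewrite mulN1r normrN ger0_norm// invr_ge0.
Qed.

Context {X : metricType R}.
Implicit Types f : R -> X.

Definition fine f (e : R) N := forall s t, s \in `[0, 1] -> t \in `[0, 1] ->
  `|s - t| <= N.+1%:R^-1 -> mdist (f s) (f t) < e.

(** Uniform continuity of a path on [[0, 1]].  Stating it for almost all meshes
    lets one mesh be chosen for several paths, possibly in different spaces. *)
Lemma path_fine f e : is_path f -> 0 < e -> \forall N \near \oo, fine f e N.
Proof.
move=> /subspace_continuousP fc e0.
have /compact_near_coveringP/near_covering_withinP cov :=
  @segment_compact R 0 1.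
pose P N s := forall t, t \in `[0, 1] -> `|s - t| <= N.+1%:R^-1 ->
  mdist (f s) (f t) < e.
have : \forall N \near \oo, `[0, 1] `<=` P N.
  apply: cov => x x01.
  have e20 : 0 < e / 2 by rewrite divr_gt0.
  have /metricType_numDomainType.cvgrPdist_lt/(_ _ e20) := fc _ x01.
  rewrite near_withinE => /nbhs_ballP[d /= d0 dP].
  have d20 : 0 < d / 2 by rewrite divr_gt0.
  have [M _ MP] := @near_infty_natSinv_lt R (PosNum d20).
  exists (ball x (d / 2), [set N | (M <= N)%N]) => /=.
    by split; [exact: nbhsx_ballx|exists M].
  move=> [s N] /= [xs /MP /= Nd] s01 t t01 st.
  have near r : `|x - r| < d -> r \in `[0, 1] -> mdist (f x) (f r) < e / 2.
    by move=> xr r01; apply: dP.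
  rewrite (le_lt_trans (metric_triangle _ (f x) _))// (splitr e) ltrD//.
    rewrite metric_sym near// (lt_le_trans xs)// ler_pdivrMr// ler_peMr ?ltW//.
    by rewrite ltr1n.
  apply: near => //; rewrite -(subrKA s) (le_lt_trans (ler_normD _ _))//.
  by rewrite (splitr d) ltrD// (le_lt_trans st).
by apply: filterS => N PN s t s01; exact: PN.
Qed.

Definition samples f N t := walk (f \o grid N t) N.+1.

Section Fine.
Context f (e : R) N (fN : fine f e N).

Let fine_grid s t i : s \in `[0, 1] -> t \in `[0, 1] ->
  `|s - t| <= N.+1%:R^-1 -> mdist (f (grid N s i)) (f (grid N t i)) < e.
Proof.
by move=> s01 t01 st; apply: fN; rewrite ?grid_itv//; exact: dist_grid.
Qed.

Let fine_gridS s t i : s \in `[0, 1] -> t \in `[0, 1] ->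
  `|s - t| <= N.+1%:R^-1 -> mdist (f (grid N s i)) (f (grid N t i.+1)) < e.
Proof.
by move=> s01 t01 st; apply: fN; rewrite ?grid_itv//; exact: dist_gridS.
Qed.

Let fine_step t i : t \in `[0, 1] ->
  mdist (f (grid N t i)) (f (grid N t i.+1)) < e.
Proof. by move=> t01; rewrite fine_gridS// subrr normr0 invr_ge0. Qed.

Lemma last_samples t : t \in `[0, 1] -> last (f 0) (samples f N t) = f t.
Proof.
move=> t01; rewrite -[X in last (f X)](grid0 N t01)
  -[X in _ = f X](gridN N t01).
exact: (last_walk (f \o grid N t)).
Qed.

Lemma is_chain_samples t : t \in `[0, 1] -> is_chain e (f 0) (samples f N t).
Proof.
move=> t01; rewrite -[X in is_chain _ (f X)](grid0 N t01).
by apply: (@is_chain_walk _ _ _ (f \o grid N t)) => i; exact: fine_step.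
Qed.

Lemma samples_homotopic s t : s \in `[0, 1] -> t \in `[0, 1] ->
  `|s - t| <= N.+1%:R^-1 ->
  chain_homotopic e (f 0) (rcons (samples f N s) (f t)) (samples f N t).
Proof.
move=> s01 t01 st; rewrite -[X in chain_homotopic _ (f X)](grid0 N s01)
  -[X in rcons _ (f X)](gridN N t01).
apply: (@walk_ladder _ _ _ (f \o grid N s) (f \o grid N t)) => /=.
- by rewrite !grid0.
- by move=> i; exact: fine_step.
- by move=> i; exact: fine_step.
- by move=> i; exact: fine_grid.
- by move=> i; exact: fine_gridS.
Qed.

End Fine.
End Sampling.

(** * Lifts of a path to the space of chains *)

Section Lifts.
Context {R : realType} {X : metricType R} (base : X) (eps : R).
Local Notation cover := (chain_cover base eps).
Local Notation rep u := (sval (repr (u : cover))).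

Let rep_chain (u : cover) : is_chain eps base (rep u).
Proof. exact: svalP (repr u). Qed.

Lemma cover_eqP (u v : cover) :
  u = v <-> chain_homotopic eps base (rep u) (rep v).
Proof.
split=> [->|uv]; first exact: rst_refl.
by rewrite -(reprK u) -(reprK v); apply/eqmodP/asboolP.
Qed.

Lemma cover_rep p : is_chain eps base p ->
  exists u : cover, chain_homotopic eps base (rep u) p.
Proof.
move=> cp; pose c : chain_from base eps := exist _ p cp.
by exists (\pi_cover c); exact: repr_chain_homotopic.
Qed.

(** Points of the cover that move by less than [eps] at each step are tracked,
    up to homotopy, by their endpoints in [X]. *)
Lemma walk_cover (w : nat -> cover) n :
  (forall i, mdist (w i) (w i.+1) < eps) ->
  chain_homotopic eps base (rep (w n))
    (rep (w 0) ++ walk (@cover_end _ _ _ _ \o w) n).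
Proof.
move=> weps; elim: n => [|n IH]; first by rewrite cats0; exact: rst_refl.
rewrite /walk mkseqS -rcons_cat.
have step := chain_dist_homotopic_rcons (rep_chain _) (rep_chain _) (weps n).
apply: (chain_homotopic_trans step); rewrite -!cats1.
apply: chain_homotopic_catr IH.
have := rep_chain (w n.+1); rewrite (chain_homotopic_chain step) -cats1.
by rewrite is_chain_cat => /andP[].
Qed.

Lemma lift_samples (f : R -> X) (g : R -> cover) N t : is_lift f g ->
  fine g eps N -> t \in `[0, 1] ->
  chain_homotopic eps base (rep (g t)) (rep (g 0) ++ samples f N t).
Proof.
move=> [_ gf] gN t01.
have := @walk_cover (g \o grid N t) N.+1 _.
rewrite /= grid0// gridN//.
have -> : walk (@cover_end _ _ _ _ \o (g \o grid N t)) N.+1 = samples f N t.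
  by apply: eq_map => i /=; rewrite gf// grid_itv.
apply=> i; apply: gN; rewrite ?grid_itv//.
by apply: dist_gridS; rewrite subrr normr0 invr_ge0.
Qed.

(** Continuity holds because, for times [s] and [t] within one mesh of each
    other, one further step to [f t] turns the samples up to [s] into those up
    to [t]; hence the cover distance of the classes is at most the distance from
    [f s] to [f t]. *)
Lemma lift_of_samples (f : R -> X) N a : 0 < eps -> is_path f ->
  fine f eps N -> is_chain eps base a -> last base a = f 0 ->
  exists g : R -> cover, is_lift f g /\ forall t, t \in `[0, 1] ->
    chain_homotopic eps base (rep (g t)) (a ++ samples f N t).
Proof.
move=> eps0 fpath fN ca la.
have cs t : t \in `[0, 1] -> is_chain eps base (a ++ samples f N t).
  by move=> t01; rewrite is_chain_cat ca la is_chain_samples.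
have ls t : t \in `[0, 1] -> last base (a ++ samples f N t) = f t.
  by move=> t01; rewrite last_cat la last_samples.
have /choice[g gP] : forall t, exists u : cover, t \in `[0, 1] ->
    chain_homotopic eps base (rep u) (a ++ samples f N t).
  move=> t; have [t01|] := boolP (t \in `[0, 1]).
    by have [u uP] := cover_rep (cs _ t01); exists u.
  by move=> _; have [u _] := cover_rep ca; exists u.
exists g; split => //; split; last first.
  by move=> t t01; rewrite /cover_end (chain_homotopic_last (gP _ t01)) ls.
have g_le s t : s \in `[0, 1] -> t \in `[0, 1] -> `|s - t| <= N.+1%:R^-1 ->
    mdist (g s) (g t) <= mdist (f s) (f t).
  move=> s01 t01 st; rewrite mdist_coverE /cover_dist.
  have st_hom : chain_homotopic eps base (rcons (a ++ samples f N s) (f t))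
      (a ++ samples f N t).
    rewrite rcons_cat; apply: chain_homotopic_catl => //.
    by rewrite la; exact: samples_homotopic.
  rewrite (chain_dist_homotopic (rep_chain _) (rep_chain _) (gP _ s01)
    (chain_homotopic_trans (gP _ t01) (chain_homotopic_sym st_hom))).
  rewrite -(ls _ s01); apply: chain_dist_rcons.
  by rewrite (chain_homotopic_chain st_hom) cs.
apply/subspace_continuousP => s s01.
apply/metricType_numDomainType.cvgrPdist_lt => e e0.
have /subspace_continuousP/(_ s s01) := fpath.
move=> /metricType_numDomainType.cvgrPdist_lt/(_ _ e0).
rewrite !near_withinE => fs; near=> t => t01.
apply: (le_lt_trans (g_le _ _ s01 t01 _)); last by move: t01; near: t.
by apply: ltW; near: t; apply: (nbhsx_ballx s); rewrite invr_gt0.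
Unshelve. all: by end_near. Qed.

End Lifts.

(** * Dependence on the scale *)

Section Monotonicity.
Context {R : realType} {X : metricType R} (base : X) (geodesicX : geodesic X).

Lemma geodesic_chain (e : R) (x : X) : 0 < e ->
  exists2 a, is_chain e base a & last base a = x.
Proof.
move=> e0; have [f [fpath f0 f1 _]] := geodesicX base x.
have [N fN] := @filter_ex _ \oo _ _ (path_fine fpath e0).
have one01 : 1 \in `[0, 1 : R] by rewrite in_itv /= lexx ler01.
exists (samples f N 1); rewrite -f0 -?f1.
  exact: is_chain_samples.
by rewrite last_samples.
Qed.

(** Comparing the samples up to time 0, which only repeat [f 0], with those up
    to time 1 transfers closedness from a lift at scale [d] to any lift at scale
    [e]. *)
Lemma lifts_closedW (d e : R) (f : R -> X) : 0 < d -> d <= e -> is_path f ->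
  lifts_closed base d f -> lifts_closed base e f.
Proof.
move=> d0 de fpath fd g gf.
have zero01 : 0 \in `[0, 1 : R] by rewrite in_itv /= lexx ler01.
have one01 : 1 \in `[0, 1 : R] by rewrite in_itv /= lexx ler01.
have e0 := lt_le_trans d0 de.
have [N [fN gN]] := @filter_ex _ \oo _ _
  (filterI (path_fine fpath d0) (path_fine gf.1 e0)).
have [a ca la] := geodesic_chain (f 0) d0.
have [h [hf hs]] := lift_of_samples d0 fpath fN ca la.
have ends : chain_homotopic d (f 0) (samples f N 0) (samples f N 1).
  rewrite -la; apply: (chain_homotopic_catlI ca); rewrite ?la.
  - exact: is_chain_samples.
  - exact: is_chain_samples.
  - apply: chain_homotopic_trans (chain_homotopic_sym (hs _ zero01)) _.
    by rewrite (fd _ hf); exact: hs.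
apply/cover_eqP.
apply: chain_homotopic_trans (lift_samples gf gN zero01) _.
apply: chain_homotopic_trans _ (chain_homotopic_sym (lift_samples gf gN one01)).
apply: chain_homotopic_catl; first exact: svalP (repr (g 0)).
have -> : last base (sval (repr (g 0))) = f 0 by exact: gf.2.
exact: chain_homotopicW ends.
Qed.

End Monotonicity.

Theorem lemma4p6 (R : realType) (X : metricType R) (base : X)
    (geodesicX : geodesic X) (x : X) (singularx : singular x) :
  degenerate base x \/ sequentially_singular base x.
Proof.
have [?|ndeg] := pselect (degenerate base x); [by left|right].
have [U Ux openU] : exists2 U, nbhs x U & forall f, is_loop_at x f ->
    f @` `[0, 1] `<=` U -> ~ null_homotopic f ->
    exists2 eps : R, 0 < eps & lifts_open base eps f.
  apply: contrapT => noU; apply: ndeg; split=> // U Ux; apply: contrapT => nof.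
  apply: noU; exists U => // f fx fU fnull; apply: contrapT => noeps.
  apply: nof; exists f; split=> // eps eps0; apply: contrapT => fopen.
  by apply: noeps; exists eps.
have /nbhs_ballP[r0 /= r0_gt0 r0U] := Ux.
have step (r : R) : exists fr : (R -> X) * R, 0 < r <= r0 ->
    [/\ 0 < fr.2, fr.2 <= r / 2, is_loop_at x fr.1,
        fr.1 @` `[0, 1] `<=` ball x r & lifts_open base fr.2 fr.1].
  have [/andP[r_gt0 rr0]|] := boolP (0 < r <= r0); last by exists (cst x, 0).
  have [f [fx fr fnull]] : exists f : R -> X, [/\ is_loop_at x f,
      f @` `[0, 1] `<=` ball x r & ~ null_homotopic f].
    apply: contrapT => nof; apply: singularx.
    exists (ball x r); first exact: nbhsx_ballx.
    by move=> f fx fr; apply: contrapT => fnull; apply: nof; exists f.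
  have [|eps eps0 fopen] := openU f fx _ fnull.
    by apply: subset_trans fr (subset_trans _ r0U); exact: le_ball.
  exists (f, Num.min eps (r / 2)) => _ /=.
  have min_gt0 : 0 < Num.min eps (r / 2) by rewrite lt_min eps0 divr_gt0.
  split=> //; first by rewrite ge_min lexx orbT.
  have [fpath _ _] := fx.
  move=> fclosed; apply: fopen.
  apply: (lifts_closedW geodesicX min_gt0 _ fpath fclosed).
  by rewrite ge_min lexx.
have [F FP] := choice step.
pose r n := iter n (fun s => (F s).2) r0.
have r_itv n : 0 < r n <= r0.
  elim: n => [|n /[dup] IH /andP[rn_gt0 rnr0]] /=; first by rewrite r0_gt0 /=.
  have [-> rS _ _ _] := FP _ IH; rewrite (le_trans rS)//=.
  by rewrite ler_pdivrMr// (le_trans rnr0)// ler_peMr ?ltW// ltr1n.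
have r_half n : r n.+1 <= r n / 2 by have [] := FP _ (r_itv n).
split=> //; exists (fun n => (F (r n)).1), r; split.
- by move=> n; have /andP[] := r_itv n.
- move=> n; have /andP[rn _] := r_itv n.
  by rewrite (le_lt_trans (r_half n))// ltr_pdivrMr// ltr_pMr// ltr1n.
- have r_le n : r n <= geometric r0 2^-1 n.
    elim: n => [|n IH]; first by rewrite /= expr0 mulr1.
    rewrite (le_trans (r_half n))// /geometric /= exprSr mulrA.
    by rewrite ler_pM2r.
  apply: (@squeeze_cvgr _ _ _ _ (cst 0) (geometric r0 2^-1)).
  + by apply: nearW => n; rewrite r_le andbT; have /andP[/ltW] := r_itv n.
  + exact: cvg_cst.
  + by apply: cvg_geometric; rewrite ger0_norm ?invr_ge0// invf_lt1// ltr1n.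
- by move=> n; have [] := FP _ (r_itv n).
Qed.
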